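(* Every consistent atomic RCC8 network over $\{\mathbf{TPP},\mathbf{TPP}^{-1}\}$ has a convex solution in $\mathbb{R}$.
   Context: A region in $\mathbb{R}^n$ ($n\geq 1$) is a nonempty regular closed subset $X$, i.e. $X=\mathrm{cl}(\mathrm{int}(X))$; write $i(X)$ for the interior. The eight RCC8 base relations between regions $a,b$ (jointly exhaustive and pairwise disjoint; $\subset$ denotes proper inclusion) are: $a\,\mathbf{EQ}\,b$: $a=b$; $a\,\mathbf{DC}\,b$: $a\cap b=\emptyset$; $a\,\mathbf{EC}\,b$: $a\cap b\neq\emptyset$ and $i(a)\cap i(b)=\emptyset$; $a\,\mathbf{PO}\,b$: $i(a)\cap i(b)\neq\emptyset$, $a\not\subseteq b$, $b\not\subseteq a$; $a\,\mathbf{TPP}\,b$: $a\subset b$ and $a\not\subset i(b)$; $a\,\mathbf{NTPP}\,b$: $a\subset i(b)$; and the converses $\mathbf{TPP}^{-1}$, $\mathbf{NTPP}^{-1}$ of the last two. Let $V$ be a finite set of variables. An RCC8 constraint is an expression $u\,R\,v$ with $u,v\in V$ and $R$ a nonempty set of base relations; an RCC8 network is a set of such constraints. It is atomic if for every pair of distinct variables $u,v$ it contains a constraint $u\,R\,v$ or $v\,R\,u$ with $R$ a singleton. It is a network over a set $\mathcal{R}$ of base relations if every constraint $u\,R\,v$ in it has $R\subseteq\mathcal{R}$. An $n$-dimensional solution (solution in $\mathbb{R}^n$) of a network is a map $\mathcal{S}$ from $V$ to regions of $\mathbb{R}^n$ such that for each constraint $u\,R\,v$ the base relation holding between $\mathcal{S}(u)$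 and $\mathcal{S}(v)$ belongs to $R$. A network is consistent if it has a solution in $\mathbb{R}^n$ for some $n\geq 1$ (the regions need not be convex or connected). A solution is convex if every $\mathcal{S}(v)$ is a convex set. *)

(* Defs.v *)
From mathcomp Require Import all_boot all_order all_algebra.
From mathcomp Require Import all_classical all_reals all_analysis.

Set Implicit Arguments.
Unset Strict Implicit.
Unset Printing Implicit Defensive.

Import numFieldNormedType.Exports.

Local Open Scope classical_set_scope.

Definition region (T : topologicalType) (X : set T) : Prop :=
  X !=set0 /\ regclosed X.

Inductive rcc8 : Type := EQ | DC | EC | PO | TPP | NTPP | TPPi | NTPPi.

(* [A `<` B] is proper inclusion, also when [B] is an interior. *)
Definition rcc8_holds (T : topologicalType) (r : rcc8) (a b : set T) : Prop :=
  let tpp (x y : set T) := x `<` y /\ ~ (x `<` interior y) in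
  let ntpp (x y : set T) := x `<` interior y in
  match r with
  | EQ => a = b
  | DC => a `&` b = set0
  | EC => a `&` b !=set0 /\ interior a `&` interior b = set0
  | PO => [/\ interior a `&` interior b !=set0, ~ (a `<=` b) & ~ (b `<=` a)]
  | TPP => tpp a b
  | NTPP => ntpp a b
  | TPPi => tpp b a
  | NTPPi => ntpp b a
  end.

Record constraint (V : Type) : Type := Constraint {
  lhs : V;
  crel : set rcc8;
  rhs : V;
  crel_nonempty : crel !=set0
}.

Definition network (V : finType) : Type := set (constraint V).

Definition atomic (V : finType) (N : network V) : Prop :=
  forall u v : V, u <> v ->
    exists2 c, N c &
      (exists r, crel c = [set r]) /\
      (lhs c = u /\ rhs c = v \/ lhs c = v /\ rhs c = u).

Definition network_over (V : finType) (B : set rcc8) (N : network V) : Prop :=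
  forall c, N c -> crel c `<=` B.

(* R^n is ['rV[R]_n] with its product topology; the real line is [n = 1].
   The base relations are jointly exhaustive and pairwise disjoint on regions, so
   asking for some [r] in [crel c] amounts to asking that the one base relation
   that holds belongs to [crel c]. *)
Definition solution (R : realType) (V : finType) (n : nat) (N : network V)
    (S : V -> set 'rV[R]_n) : Prop :=
  (forall v, region (S v)) /\
  forall c, N c ->
    exists2 r, crel c r & rcc8_holds r (S (lhs c)) (S (rhs c)).

Definition consistent (R : realType) (V : finType) (N : network V) : Prop :=
  exists2 n, (1 <= n)%N & exists S : V -> set 'rV[R]_n, solution N S.

Definition convex_solution (R : realType) (V : finType) (n : nat)
    (N : network V) (S : V -> set 'rV[R]_n) : Prop :=
  solution N S /\ forall v, convex_set (S v).

(* Main.v *)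
(** Inclusion orders the regions of any solution, so v can be assigned the
    interval [0, 2r] with r = 1 + #{w : S w proper subset of S v}.  These
    intervals grow strictly with r, and none is contained in the interior of
    another since they share the endpoint 0. *)

Require Import Defs.
From mathcomp Require Import all_boot all_order all_algebra.
From mathcomp Require Import all_classical all_reals all_analysis.

Import Order.TTheory GRing.Theory Num.Theory numFieldNormedType.Exports.

Local Open Scope classical_set_scope.

Section tangent_balls.
Local Open Scope ring_scope.
Local Open Scope convex_scope.
Context {R : realType} {W : normedModType R}.
Implicit Types (c e x : W) (r s : R).

Lemma closed_ball_region c r : 0 < r -> region (closed_ball c r).
Proof.
move=> r0; split; first by exists c; exact: closed_ballxx.
exact/closure_open_regclosed/ball_open.
Qed.

Lemma convex_closed_ball c r : 0 < r -> convex_set (closed_ball c r).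
Proof.
move=> r0; apply/convex_setW => x y; rewrite closed_ballE// !inE /closed_ball_ /=.
move=> cx cy k k0 k1; rewrite inE /=.
(* The centre is itself the convex combination of [c] with [c], so the difference splits. *)
have -> : c - (x <| k |> y) = k%:num *: (c - x) + (1 - k%:num) *: (c - y).
  by rewrite -[in LHS](@convmm _ (convex_lmodType W) k c) opprD addrACA -!scalerBr.
rewrite (le_trans (ler_normD _ _))// !normrZ (gtr0_norm k0) gtr0_norm ?subr_gt0//.
have -> : r = k%:num * r + (1 - k%:num) * r by rewrite -mulrDl addrC subrK mul1r.
by rewrite lerD// ler_wpM2l// ?ltW// subr_gt0.
Qed.

(** For [|e| = 1] and [r > 0], the bounding sphere passes through 0, where all these balls touch. *)
Definition tangent_ball e r := closed_ball (r *: e) r.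

Lemma tangent_ball_TPP e r s : `|e| = 1 -> 0 < r -> r < s ->
  rcc8_holds TPP (tangent_ball e r) (tangent_ball e s).
Proof.
move=> e1 r0 rs; have s0 := lt_trans r0 rs.
split; last first.
  (* 0 lies in the smaller ball, but at distance exactly [s] from the larger centre, hence not in
     the interior. *)
  move=> [sub _]; have /sub : tangent_ball e r 0.
    by rewrite /tangent_ball closed_ballE//= /closed_ball_ /= subr0 normrZ e1 mulr1 gtr0_norm.
  rewrite /tangent_ball interior_closed_ballE// -ball_normE /= subr0.
  by rewrite normrZ e1 mulr1 gtr0_norm// ltxx.
rewrite /tangent_ball !closed_ballE// /closed_ball_ /=; split=> [x /= rx|].
  (* The centres are [s - r] apart. *)
  have -> : s *: e - x = (s - r) *: e + (r *: e - x).
    by rewrite scalerBl subrKA.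
  rewrite (le_trans (ler_normD _ _))// normrZ e1 mulr1 gtr0_norm ?subr_gt0//.
  by rewrite (le_trans (lerD (lexx _) rx))// subrK.
(* The antipode of 0 in the larger ball is at distance [2s - r > r] from the smaller centre. *)
move=> /(_ ((s + s) *: e)) /=; rewrite -!scalerBl !normrZ e1 !mulr1 => sub.
have : `|r - (s + s)| <= r.
  by apply: sub; rewrite opprD addrA subrr sub0r normrN gtr0_norm.
rewrite distrC gtr0_norm; last by rewrite subr_gt0 ltr_wpDl// ltW.
by rewrite lerBlDr leNgt ltrD.
Qed.

End tangent_balls.

Theorem proposition2 (R : realType) (V : finType) (N : network V) :
  atomic N -> network_over [set TPP; TPPi] N -> consistent R N ->
  exists S : V -> set 'rV[R]_1, convex_solution N S.
Proof.
move=> _ N_over [n _ [S [_ S_sol]]].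
pose below v := [set w | `[< S w `<` S v >]]%SET.
pose radius v : R := (#|below v|.+1%:R)%R.
have radius_gt0 v : (0 < radius v)%R by rewrite ltr0n.
have radius_lt u v : S u `<` S v -> (radius u < radius v)%R.
  move=> [Suv Svu]; rewrite ltr_nat ltnS proper_card//; apply/properP; split.
    apply/fintype.subsetP => w; rewrite !inE => -[Swu Suw].
    split; first exact: subset_trans Swu Suv.
    by move=> Svw; apply: Suw; exact: subset_trans Suv Svw.
  (* [u] lies in [below v] but not in [below u], so the count grows strictly. *)
  by exists u; rewrite inE; apply/asboolP => // -[].
have [e e1] : exists e : 'rV[R]_1, `|e|%R = 1%R.
  (* A nonzero matrix norm is attained at some entry, and every entry here is 1. *)
  exists (const_mx 1%R); have := @mx_norm_neq0 R 1 1 (const_mx 1%R).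
  case=> [|i norm_e]; last by rewrite [LHS]norm_e mxE normr1.
  apply/eqP => /mx_norm_eq0/matrixP/(_ 0%R 0%R); rewrite !mxE.
  by apply/eqP; rewrite oner_eq0.
exists (fun v => tangent_ball e (radius v)); split; last first.
  by move=> v; exact: convex_closed_ball.
split=> [v|c Nc]; first exact: closed_ball_region.
have [r cr Sr] := S_sol c Nc; exists r => //.
(* [TPPi] unfolds to [TPP] with the regions swapped, so one argument settles both cases. *)
by case: (N_over c Nc r cr) Sr => -> [/radius_lt lt_r _];
  exact: tangent_ball_TPP.
Qed.
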